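(* $\langle\forall\exists\forall\rangle\not\le_{\sf m}\langle\exists^\infty\forall^\infty\forall\rangle$.
   Context: Quantifiers range over $\omega$. $\exists^\infty n\,\varphi(n)$ means $\forall m\exists n\ge m\,\varphi(n)$ and $\forall^\infty n\,\varphi(n)$ means $\exists m\forall n\ge m\,\varphi(n)$. A quantifier-pattern is a finite string $\bar{\mathsf Q}=\mathsf Q_0\dots\mathsf Q_\ell$ over $\{\exists,\forall,\exists^\infty,\forall^\infty\}$. A $\bar{\mathsf Q}$-formula is $\varphi(\bar x)\equiv\mathsf Q_0n_0\dots\mathsf Q_\ell n_\ell\,\theta(n_0,\dots,n_\ell,\bar x)$ with $\theta$ bounded. The instance $\bar x$ is a tuple of natural numbers and/or total computable functions (computable elements of $\omega^\omega$). Spaces such as $\omega\times\omega^\omega$, $(\omega^\omega)^\omega$, $\omega^{\omega\times\omega}$ are identified with $\omega^\omega$ by computable pairing. Witnesses: for $\alpha\in\omega^\omega$, $\alpha\Vdash\varphi(\bar x)$ (''$\alpha$ is a witness for $\varphi(\bar x)$'') is defined by: $\alpha\Vdash\theta(\bar x)$ iff $\alpha=\bar x$ and $\theta(\bar x)$, for bounded $\theta$; $\langle t,\alpha\rangle\Vdash\exists n\varphi(n,\bar x)$ iff $\alpha\Vdash\varphi(t,\bar x)$; $\alpha\Vdash\forall n\varphi(n,\bar x)$ iff $\alpha(n)\Vdash\varphi(n,\bar x)$ for all $n$; $\langle t,\alpha\rangle\Vdash\forall^\infty n\varphi(n,\bar x)$ iff $\alpha(n)\Vdash\varphi(n,\bar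 x)$ for all $n\ge t$; $\alpha\Vdash\exists^\infty n\varphi(n,\bar x)$ iff for all $n$, writing $\alpha(n)=\langle k,\beta\rangle$, $k\ge n$ and $\beta\Vdash\varphi(k,\bar x)$. $\varphi\le_{\sf m}\psi$ if there are computable functions $\eta,r_-,r_+$ (type-two computable functionals, possibly partial but defined wherever required) such that for every instance $\bar x$: $\varphi(\bar x)$ is true iff $\psi(\eta(\bar x))$ is true; $\alpha\Vdash\varphi(\bar x)$ implies $r_-(\alpha,\bar x)\Vdash\psi(\eta(\bar x))$; $\alpha\Vdash\psi(\eta(\bar x))$ implies $r_+(\alpha,\bar x)\Vdash\varphi(\bar x)$ ($\alpha\in\omega^\omega$ arbitrary). $\langle\bar{\mathsf Q}\rangle$ denotes a fixed $\bar{\mathsf Q}$-formula to which every $\bar{\mathsf Q}$-formula is $\le_{\sf m}$-reducible; concretely $\langle\bar{\mathsf Q}\rangle(x)\equiv\mathsf Q_0n_0\dots\mathsf Q_\ell n_\ell.\ x(n_0,\dots,n_\ell)=0$ (the choice does not matter up to $\equiv_{\sf m}$). *)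

(* Defs.v *)
From Stdlib Require Import Arith List Cantor.
Import ListNotations.

(** * Baire space and its pairings *)

Definition baire := nat -> nat.

Definition pair (a b : nat) : nat := Cantor.to_nat (a, b).
Definition left (c : nat) : nat := fst (Cantor.of_nat c).
Definition right (c : nat) : nat := snd (Cantor.of_nat c).

(** [omega * omega^omega = omega^omega]: the pair <t, alpha> is the sequence
    t, alpha(0), alpha(1), and so on. *)
Definition bcons (t : nat) (alpha : baire) : baire :=
  fun n => match n with 0 => t | S m => alpha m end.
Definition bhead (alpha : baire) : nat := alpha 0.
Definition btail (alpha : baire) : baire := fun n => alpha (S n).

(** [(omega^omega)^omega = omega^omega]: [row alpha n] is alpha(n). *)
Definition row (alpha : baire) (n : nat) : baire := fun m => alpha (pair n m).

(** [omega^omega * omega^omega = omega^omega], pointwise. *)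
Definition bpair (alpha beta : baire) : baire := fun n => pair (alpha n) (beta n).

(** <n_0, <n_1, ... <n_l, x>>>. *)
Definition btuple (ns : list nat) (x : baire) : baire := fold_right bcons x ns.

(** The argument at which [x : baire], read as a function of several variables,
    is evaluated. *)
Fixpoint tuple_code (ns : list nat) : nat :=
  match ns with
  | [] => 0
  | [n] => n
  | n :: ns' => pair n (tuple_code ns')
  end.

(** * Computability *)

(** Partial recursive functions relative to an oracle, as unary functions over
    paired arguments. *)
Inductive code : Type :=
| Zero | Succ | Left | Right | Oracle
| Pair (f g : code)
| Comp (f g : code)
| Prec (f g : code)
| Mu (f : code).

(** [eval o c a v]: the program [c] with oracle [o] halts on input [a] with
    output [v]. *)
Fixpoint eval (o : baire) (c : code) (a v : nat) : Prop :=
  match c with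
  | Zero => v = 0
  | Succ => v = S a
  | Left => v = left a
  | Right => v = right a
  | Oracle => v = o a
  | Pair f g => exists u w, eval o f a u /\ eval o g a w /\ v = pair u w
  | Comp f g => exists u, eval o g a u /\ eval o f u v
  | Prec f g =>
      (fix rec (n v : nat) : Prop :=
         match n with
         | 0 => eval o f (left a) v
         | S m => exists i, rec m i /\ eval o g (pair (left a) (pair m i)) v
         end) (right a) v
  | Mu f => eval o f (pair a v) 0 /\
            forall m, m < v -> exists u, eval o f (pair a m) (S u)
  end.

Definition computable (x : baire) : Prop :=
  exists c, forall n, eval (fun _ => 0) c n (x n).

(** The partial type-two functional with program [c] is defined at [alpha], with
    value [beta]. *)
Definition computes (c : code) (alpha beta : baire) : Prop :=
  forall n, eval alpha c n (beta n).

(** * Formulas, truth and witnesses *)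

Inductive quantifier : Type := Ex | All | ExInf | AllInf.

(** The matrix is kept semantically, as a predicate of the quantified numbers
    n_0, ..., n_l and the instance; the only matrix used below is the atomic
    formula x(n_0, ..., n_l) = 0. *)
Record formula : Type := Formula {
  pattern : list quantifier;
  matrix : list nat -> baire -> Prop
}.

(** [ns] lists the values already substituted for the outer quantified
    variables, outermost first. *)
Fixpoint holds_from (Q : list quantifier) (theta : list nat -> baire -> Prop)
    (ns : list nat) (x : baire) : Prop :=
  match Q with
  | [] => theta ns x
  | q :: Q' =>
      let phi n := holds_from Q' theta (ns ++ [n]) x in
      match q with
      | Ex => exists n, phi n
      | All => forall n, phi n
      | ExInf => forall m, exists n, m <= n /\ phi n
      | AllInf => exists m, forall n, m <= n -> phi n
      end
  end.

(** In the base case the parameters of the matrix are the numbers [ns] together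
    with the instance [x], so the witness has to be the tuple of all of them. *)
Fixpoint witness_from (Q : list quantifier) (theta : list nat -> baire -> Prop)
    (ns : list nat) (x : baire) (alpha : baire) : Prop :=
  match Q with
  | [] => (forall i, alpha i = btuple ns x i) /\ theta ns x
  | q :: Q' =>
      let wit n beta := witness_from Q' theta (ns ++ [n]) x beta in
      match q with
      | Ex => wit (bhead alpha) (btail alpha)
      | All => forall n, wit n (row alpha n)
      | ExInf => forall n,
          n <= bhead (row alpha n) /\
          wit (bhead (row alpha n)) (btail (row alpha n))
      | AllInf => forall n, bhead alpha <= n -> wit n (row (btail alpha) n)
      end
  end.

Definition holds (phi : formula) (x : baire) : Prop :=
  holds_from (pattern phi) (matrix phi) [] x.

Definition witness (alpha : baire) (phi : formula) (x : baire) : Prop :=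
  witness_from (pattern phi) (matrix phi) [] x alpha.

(** Instances are the computable elements of Baire space; the functionals need
    only be defined where they are used, and [y] is the value of eta at [x]. *)
Definition m_reducible (phi psi : formula) : Prop :=
  exists eta r_minus r_plus : code,
    forall x, computable x ->
      exists y,
        computes eta x y /\ computable y /\
        (holds phi x <-> holds psi y) /\
        (forall alpha, witness alpha phi x ->
           exists beta, computes r_minus (bpair alpha x) beta /\
                        witness beta psi y) /\
        (forall alpha, witness alpha psi y ->
           exists beta, computes r_plus (bpair alpha x) beta /\
                        witness beta phi x).

(** The complete formula Q_0 n_0 ... Q_l n_l. x(n_0, ..., n_l) = 0. *)
Definition complete (Q : list quantifier) : formula :=
  Formula Q (fun ns x => x (tuple_code ns) = 0).

(* Main.v *)
(** Only the instance [x = 0] and its modifications at a single point matter.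
    A witness for [forall exists forall] at [x = 0] is an arbitrary [b : baire];
    let K(b) be the infinite set of numbers [k] that [r_minus] makes of it as
    witnesses of the quantifier [ExInf], and let E_a be the set of those [k] that
    belong to K(b) and K(b') for some [b], [b'] with [b a <> b' a].

    E_a is finite: otherwise its elements form a witness at the instance 0, from
    which [r_plus] reads off a value [p] for the variable [a] after finitely many
    steps.  Refuting [p] far out keeps each of the finitely many [k] that were
    used, since it comes from some [b] with [b a <> p], yet [r_plus] still
    answers [p].

    By continuity of [r_minus] every [k] in K(b) lies in some E_a.  An element of
    E_(a+1) outside E_a determines [b a], so there is a [b] with [b a] different
    from the finitely many values determined in this way, for all [a].  Then
    K(b) is contained in E_0 and hence finite, a contradiction. *)

Require Import Defs.
From Stdlib Require Import List Arith Lia Cantor Classical ClassicalEpsilon.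
Import ListNotations.

(** * Pairing, and continuity of oracle programs *)

Lemma left_pair (a b : nat) : left (pair a b) = a.
Proof. unfold left, pair; now rewrite cancel_of_to. Qed.

Lemma right_pair (a b : nat) : right (pair a b) = b.
Proof. unfold right, pair; now rewrite cancel_of_to. Qed.

Lemma pair_left_right (c : nat) : pair (left c) (right c) = c.
Proof.
  unfold left, right, pair.
  rewrite <- surjective_pairing; apply cancel_to_of.
Qed.

Lemma pair_ge (a b : nat) : a <= pair a b /\ b <= pair a b.
Proof. unfold pair; pose proof (to_nat_non_decreasing a b); lia. Qed.

Lemma left_le (c : nat) : left c <= c.
Proof. rewrite <- (pair_left_right c) at 2; apply pair_ge. Qed.

Lemma right_le (c : nat) : right c <= c.
Proof. rewrite <- (pair_left_right c) at 2; apply pair_ge. Qed.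

Lemma eval_functional (o : baire) (c : code) :
  forall a v w, eval o c a v -> eval o c a w -> v = w.
Proof.
  induction c as [| | | | | f IHf g IHg | f IHf g IHg | f IHf g IHg | f IHf];
    simpl; intros a v w Hv Hw; try congruence.
  - destruct Hv as (u1 & w1 & A1 & B1 & ->), Hw as (u2 & w2 & A2 & B2 & ->).
    now rewrite (IHf _ _ _ A1 A2), (IHg _ _ _ B1 B2).
  - destruct Hv as (u1 & A1 & B1), Hw as (u2 & A2 & B2).
    rewrite (IHg _ _ _ A1 A2) in B1; eauto.
  - revert v w Hv Hw; induction (right a) as [|m IHm]; intros v w Hv Hw; [eauto|].
    destruct Hv as (i & A1 & B1), Hw as (j & A2 & B2).
    rewrite (IHm _ _ A1 A2) in B1; eauto.
  - destruct Hv as [A1 B1], Hw as [A2 B2].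
    destruct (lt_eq_lt_dec v w) as [[L|L]|L]; [|exact L|].
    + destruct (B2 _ L) as [u Hu]. discriminate (IHf _ _ _ A1 Hu).
    + destruct (B1 _ L) as [u Hu]. discriminate (IHf _ _ _ A2 Hu).
Qed.

(** Merges finitely many bounds, typically uses of computations, into a single one. *)
Lemma bounded_collection (P : nat -> nat -> Prop) (N : nat) :
  (forall n u v, u <= v -> P n u -> P n v) ->
  (forall n, n < N -> exists u, P n u) ->
  exists U, forall n, n < N -> P n U.
Proof.
  intros mono; induction N as [|N IH]; intros H.
  - exists 0; lia.
  - destruct IH as [U HU]; [intros; apply H; lia|].
    destruct (H N) as [u Hu]; [lia|].
    exists (U + u); intros n Hn.
    destruct (Nat.eq_dec n N) as [->|].
    + eapply mono; [|exact Hu]; lia.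
    + eapply mono; [|apply HU]; lia.
Qed.

Definition agree (u : nat) (o o' : baire) : Prop := forall i, i < u -> o' i = o i.

Lemma agree_le (u v : nat) (o o' : baire) : u <= v -> agree v o o' -> agree u o o'.
Proof. intros H A i Hi; apply A; lia. Qed.

(** A halting computation queries its oracle finitely often; [u] lies above all queries. *)
Lemma eval_use (o : baire) (c : code) :
  forall a v, eval o c a v ->
  exists u, forall o', agree u o o' -> eval o' c a v.
Proof.
  induction c as [| | | | | f IHf g IHg | f IHf g IHg | f IHf g IHg | f IHf];
    simpl; intros a v Hv; try (exists 0; easy).
  - exists (S a); intros o' A; rewrite A; auto.
  - destruct Hv as (u1 & w1 & A1 & B1 & ->).
    destruct (IHf _ _ A1) as [m Hm], (IHg _ _ B1) as [n Hn].
    exists (m + n); intros o' A; exists u1, w1; repeat split.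
    + apply Hm; eapply agree_le; [|exact A]; lia.
    + apply Hn; eapply agree_le; [|exact A]; lia.
  - destruct Hv as (u1 & A1 & B1).
    destruct (IHg _ _ A1) as [m Hm], (IHf _ _ B1) as [n Hn].
    exists (m + n); intros o' A; exists u1; split.
    + apply Hm; eapply agree_le; [|exact A]; lia.
    + apply Hn; eapply agree_le; [|exact A]; lia.
  - revert v Hv; induction (right a) as [|k IHk]; intros v Hv; [eauto|].
    destruct Hv as (i & A1 & B1).
    destruct (IHk _ A1) as [m Hm], (IHg _ _ B1) as [n Hn].
    exists (m + n); intros o' A; exists i; split.
    + apply Hm; eapply agree_le; [|exact A]; lia.
    + apply Hn; eapply agree_le; [|exact A]; lia.
  - destruct Hv as [A1 B1].
    destruct (IHf _ _ A1) as [m Hm].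
    (* The search also ran [f] on every [j < v], so the uses of all these failed tests are
       merged. *)
    destruct (bounded_collection
      (fun j n => forall o', agree n o o' -> exists u, eval o' f (pair a j) (S u)) v)
      as [n Hn].
    + intros j n1 n2 L H o' A; apply H; eapply agree_le; eauto.
    + intros j Hj; destruct (B1 j Hj) as [u Hu].
      destruct (IHf _ _ Hu) as [n Hn]; exists n; eauto.
    + exists (m + n); intros o' A; split.
      * apply Hm; eapply agree_le; [|exact A]; lia.
      * intros j Hj; apply Hn; [exact Hj|]; eapply agree_le; [|exact A]; lia.
Qed.

(** * The instance [zero] and its modifications at one point *)

Definition spike (z : nat) : baire := fun n => if Nat.eqb n z then 1 else 0.

(** By induction on [z]: [spike (S z)] is 0 at 0 and takes the value of [spike z] at [n] when
    applied to [S n], a degenerate primitive recursion. *)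
Lemma computable_spike (z : nat) : computable (spike z).
Proof.
  induction z as [|z [c Hc]].
  (* [Pair Left Right] is the identity program; the outer [Pair Zero] supplies the dummy parameter
     that [Prec] expects beside its counter. *)
  - exists (Comp (Prec (Comp Succ Zero) Zero) (Pair Zero (Pair Left Right))).
    intros n; exists (pair 0 n); split.
    + simpl; exists 0, n; repeat split.
      exists (left n), (right n); repeat split; now rewrite pair_left_right.
    + cbn [eval]; rewrite right_pair; induction n as [|n IH].
      * now exists 0.
      * exists (spike 0 n); split; [exact IH | reflexivity].
  - exists (Comp (Prec Zero (Comp c (Comp Left Right))) (Pair Zero (Pair Left Right))).
    intros n; exists (pair 0 n); split.
    + simpl; exists 0, n; repeat split.
      exists (left n), (right n); repeat split; now rewrite pair_left_right.
    + cbn [eval]; rewrite right_pair; generalize (left (pair 0 n)) as d; intros d;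
      induction n as [|n IH].
      * reflexivity.
      * exists (spike (S z) n); split; [exact IH|].
        exists n; split; [|apply Hc].
        exists (pair n (spike (S z) n)); now rewrite right_pair, left_pair.
Qed.

Definition zero : baire := fun _ => 0.

Lemma computable_zero : computable zero.
Proof. exists Zero; reflexivity. Qed.

Lemma spike_agree (z u : nat) : u <= z -> agree u zero (spike z).
Proof.
  intros H i Hi; unfold spike, zero.
  destruct (Nat.eqb_spec i z); [lia | reflexivity].
Qed.

Lemma btuple_agree (ns : list nat) (u : nat) (x x' : baire) :
  agree u x x' -> agree u (btuple ns x) (btuple ns x').
Proof.
  intros A; induction ns as [|n ns IH]; [exact A|].
  intros [|i] Hi; [reflexivity | apply IH; lia].
Qed.

Lemma bpair_agree (u : nat) (x x' y y' : baire) :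
  agree u x x' -> agree u y y' -> agree u (bpair x y) (bpair x' y').
Proof. intros A B i Hi; unfold bpair; now rewrite A, B. Qed.

(** * Witnesses in normal form *)

Definition picks (x b : baire) : Prop := forall a c, x (pair a (pair (b a) c)) = 0.

(** The only freedom in a witness of forall exists forall is the choice function [b]; all other
    entries are the tuples forced by the base case. *)
Definition aea_wit (b x : baire) : baire := fun z =>
  match right z with
  | 0 => b (left z)
  | S q => btuple [left z; b (left z); left q] x (right q)
  end.

Lemma aea_wit_witness (b x : baire) :
  picks x b -> witness (aea_wit b x) (complete [All; Ex; All]) x.
Proof.
  intros H a; simpl.
  replace (bhead (row (aea_wit b x) a)) with (b a)
    by (unfold bhead, row, aea_wit; now rewrite right_pair, left_pair).
  intros c; split; [|apply H].
  intros i; unfold btail, row, aea_wit.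
  now rewrite !right_pair, !left_pair.
Qed.

Lemma aea_witness_picks (alpha x : baire) :
  witness alpha (complete [All; Ex; All]) x -> picks x (fun a => alpha (pair a 0)).
Proof. intros H a c; apply (H a c). Qed.

(** The components of a pair do not exceed its code, so an entry below [u] consults [b] and [x] only
    below [u]. *)
Lemma aea_wit_agree (u : nat) (b b' x x' : baire) :
  agree u b b' -> agree u x x' -> agree u (aea_wit b x) (aea_wit b' x').
Proof.
  intros A B z Hz; unfold aea_wit.
  pose proof (left_le z); pose proof (right_le z).
  rewrite A by lia.
  destruct (right z) as [|q]; [reflexivity|].
  pose proof (right_le q); apply (btuple_agree _ u); [exact B | lia].
Qed.

(** [t] is a threshold for the inner quantifiers forall^infinity forall at the value [k] of the
    outer one. *)
Definition good (y : baire) (k t : nat) : Prop :=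
  forall j l, t <= j -> y (pair k (pair j l)) = 0.

Lemma good_le (y : baire) (k t t' : nat) : t <= t' -> good y k t -> good y k t'.
Proof. intros H G j l Hj; apply G; lia. Qed.

(** Here the free data are the numbers [k n] and their thresholds [t n]; the rest is forced. *)
Definition iia_wit (k t y : baire) : baire := fun z =>
  match right z with
  | 0 => k (left z)
  | 1 => t (left z)
  | S (S q) => btuple [k (left z); left q; left (right q)] y (right (right q))
  end.

Lemma iia_wit_witness (k t y : baire) :
  (forall n, n <= k n) -> (forall n, good y (k n) (t n)) ->
  witness (iia_wit k t y) (complete [ExInf; AllInf; All]) y.
Proof.
  intros Hk Hg n; simpl.
  replace (bhead (row (iia_wit k t y) n)) with (k n)
    by (unfold bhead, row, iia_wit; now rewrite right_pair, left_pair).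
  split; [apply Hk|].
  replace (bhead (btail (row (iia_wit k t y) n))) with (t n)
    by (unfold bhead, btail, row, iia_wit; now rewrite right_pair, left_pair).
  intros j Hj l; split; [|now apply Hg].
  intros i; unfold btail, row, iia_wit.
  now rewrite !right_pair, !left_pair.
Qed.

Lemma iia_witness_good (beta y : baire) :
  witness beta (complete [ExInf; AllInf; All]) y ->
  forall n, n <= beta (pair n 0) /\ good y (beta (pair n 0)) (beta (pair n 1)).
Proof.
  intros H n; destruct (H n) as [A B]; split; [exact A|].
  intros j l Hj; apply (B j Hj l).
Qed.

Lemma iia_wit_agree (u : nat) (k k' t t' y y' : baire) :
  agree u k k' -> agree u t t' -> agree u y y' ->
  agree u (iia_wit k t y) (iia_wit k' t' y').
Proof.
  intros A B C z Hz; unfold iia_wit.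
  pose proof (left_le z); pose proof (right_le z).
  rewrite A, B by lia.
  destruct (right z) as [|[|q]]; try reflexivity.
  pose proof (right_le q); pose proof (right_le (right q)).
  apply (btuple_agree _ u); [exact C | lia].
Qed.

(** * The reduction expressed through the free data of witnesses *)

Definition reduction (eta r_minus r_plus : code) : Prop :=
  forall x, computable x ->
  exists y,
    computes eta x y /\
    (forall b, picks x b ->
       exists beta, computes r_minus (bpair (aea_wit b x) x) beta /\
                    forall n, n <= beta (pair n 0) /\
                              good y (beta (pair n 0)) (beta (pair n 1))) /\
    (forall k t, (forall n, n <= k n) -> (forall n, good y (k n) (t n)) ->
       exists alpha, computes r_plus (bpair (iia_wit k t y) x) alpha /\
                     picks x (fun a => alpha (pair a 0))).

Lemma m_reducible_reduction :
  m_reducible (complete [All; Ex; All]) (complete [ExInf; AllInf; All]) ->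
  exists eta r_minus r_plus, reduction eta r_minus r_plus.
Proof.
  intros (eta & rm & rp & H); exists eta, rm, rp; intros x Hx.
  destruct (H x Hx) as (y & Hy & _ & _ & Hm & Hp).
  exists y; split; [exact Hy|]; split.
  - intros b Hb.
    destruct (Hm _ (aea_wit_witness b x Hb)) as (beta & A & B).
    exists beta; split; [exact A | now apply iia_witness_good].
  - intros k t Hk Hg.
    destruct (Hp _ (iia_wit_witness k t y Hk Hg)) as (alpha & A & B).
    exists alpha; split; [exact A | now apply aea_witness_picks].
Qed.

(** * The numbers emitted by [r_minus] at the instance [zero] *)

(** The set K(b) consists of the [k] for which this holds with some [t]. *)
Definition emits (r_minus : code) (b : baire) (k t : nat) : Prop :=
  exists n, eval (bpair (aea_wit b zero) zero) r_minus (pair n 0) k /\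
            eval (bpair (aea_wit b zero) zero) r_minus (pair n 1) t.

Lemma emits_use (r_minus : code) (b : baire) (k t : nat) :
  emits r_minus b k t ->
  exists n u, forall b' x', agree u b b' -> agree u zero x' ->
    eval (bpair (aea_wit b' x') x') r_minus (pair n 0) k /\
    eval (bpair (aea_wit b' x') x') r_minus (pair n 1) t.
Proof.
  intros (n & A & B).
  destruct (eval_use _ _ _ _ A) as [u Hu], (eval_use _ _ _ _ B) as [v Hv].
  exists n, (u + v); intros b' x' Ab Ax.
  assert (agree (u + v) (bpair (aea_wit b zero) zero) (bpair (aea_wit b' x') x'))
    by (apply bpair_agree; [apply aea_wit_agree|]; assumption).
  split; [apply Hu | apply Hv]; apply agree_le with (u + v); auto; lia.
Qed.

Lemma computes_unique (c : code) (alpha beta gamma : baire) :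
  computes c alpha beta -> computes c alpha gamma -> forall n, beta n = gamma n.
Proof. intros A B n; eapply eval_functional; eauto. Qed.

Lemma computes_use (c : code) (alpha beta : baire) (N : nat) :
  computes c alpha beta ->
  exists u, forall alpha' beta', agree u alpha alpha' -> computes c alpha' beta' ->
    agree N beta beta'.
Proof.
  intros H.
  destruct (bounded_collection
    (fun n u => forall alpha', agree u alpha alpha' -> eval alpha' c n (beta n)) N)
    as [u Hu].
  - intros n u v L K a' A; apply K; eapply agree_le; eauto.
  - intros n _; exact (eval_use _ _ _ _ (H n)).
  - exists u; intros a' b' A C n Hn.
    eapply eval_functional; [apply C | now apply Hu].
Qed.

(** On an instance close to [zero] for which [b] still picks, [r_minus] repeats the outputs [k] and
    [t], and correctness of the reduction there makes them good for the new image. *)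
Lemma emits_persists (eta r_minus r_plus : code) (b : baire) (k t : nat) :
  reduction eta r_minus r_plus -> emits r_minus b k t ->
  exists u, forall x y, computable x -> agree u zero x -> picks x b ->
    computes eta x y -> good y k t.
Proof.
  intros R E; destruct (emits_use _ _ _ _ E) as (n & u & Hu).
  exists u; intros x y Cx A P Hy.
  destruct (R x Cx) as (y' & Hy' & Hm & _).
  destruct (Hm b P) as (beta & Cb & G); destruct (G n) as [_ Gn].
  destruct (Hu b x) as [E0 E1]; [easy | exact A |].
  rewrite (eval_functional _ _ _ _ _ (Cb _) E0) in Gn.
  rewrite (eval_functional _ _ _ _ _ (Cb _) E1) in Gn.
  intros j l Hj; rewrite (computes_unique _ _ _ _ Hy Hy'); now apply Gn.
Qed.

Lemma emits_unbounded (eta r_minus r_plus : code) (b : baire) (N : nat) :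
  reduction eta r_minus r_plus -> exists k t, N <= k /\ emits r_minus b k t.
Proof.
  intros R; destruct (R zero computable_zero) as (y & _ & Hm & _).
  destruct (Hm b) as (beta & Cb & G); [easy|].
  exists (beta (pair N 0)), (beta (pair N 1)); split; [apply G|].
  exists N; split; apply Cb.
Qed.

(** * The sets E_a and their finiteness *)

(** Membership of [k] in E_a. *)
Definition ambiguous (r_minus : code) (a k : nat) : Prop :=
  exists b b' t t', emits r_minus b k t /\ emits r_minus b' k t' /\ b a <> b' a.

(** Changing [b] at the place [u], just beyond the use of the computation, leaves [k] emitted. *)
Lemma emits_ambiguous (r_minus : code) (b : baire) (k t : nat) :
  emits r_minus b k t -> exists a, ambiguous r_minus a k.
Proof.
  intros E; destruct (emits_use _ _ _ _ E) as (n & u & Hu).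
  set (b' := fun i => if Nat.eqb i u then S (b i) else b i).
  exists u, b, b', t, t; split; [exact E|]; split.
  - exists n; apply Hu; [|easy].
    intros i Hi; unfold b'; destruct (Nat.eqb_spec i u); lia.
  - unfold b'; rewrite Nat.eqb_refl; lia.
Qed.

(** Of two sources that differ at [a], at most one takes the value [p] there. The threshold [t] is
    fixed before [p], because [p] will be read off from a witness built with [t]. *)
Lemma ambiguous_emits_avoiding (r_minus : code) (a k : nat) :
  ambiguous r_minus a k ->
  exists t, forall p, exists b s, s <= t /\ emits r_minus b k s /\ b a <> p.
Proof.
  intros (b & b' & t & t' & E & E' & D); exists (t + t'); intros p.
  destruct (Nat.eq_dec (b a) p).
  - exists b', t'; repeat split; [lia | exact E' | lia].
  - exists b, t; repeat split; [lia | exact E | lia].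
Qed.

Lemma functional_choice (P : nat -> nat -> Prop) :
  (forall n, exists m, P n m) -> exists f, forall n, P n (f n).
Proof.
  intros H.
  exists (fun n => proj1_sig (constructive_indefinite_description _ (H n))).
  intros n; apply proj2_sig.
Qed.

Lemma ambiguous_bounded (eta r_minus r_plus : code) (a : nat) :
  reduction eta r_minus r_plus ->
  exists M, forall k, ambiguous r_minus a k -> k < M.
Proof.
  intros R; apply NNPP; intros unbounded.
  assert (Hk : forall n, exists k, n <= k /\ ambiguous r_minus a k).
  { intros n; apply NNPP; intros H; apply unbounded; exists n; intros k Ak.
    apply Nat.nle_gt; intros L; apply H; eauto. }
  apply functional_choice in Hk as [k Hk].
  destruct (functional_choice _
    (fun n => ambiguous_emits_avoiding _ _ _ (proj2 (Hk n)))) as [t Ht].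
  destruct (R zero computable_zero) as (y & Hy & _ & Hp).
  destruct (Hp k t) as (alpha & Ca & _).
  { apply Hk. }
  (* The avoided value 0 is arbitrary: every function picks at [zero]. *)
  { intros n; destruct (Ht n 0) as (b & s & L & E & _).
    destruct (emits_persists _ _ _ _ _ _ R E) as [u Hu].
    apply good_le with s; [exact L|].
    now apply (Hu zero y computable_zero). }
  set (p := alpha (pair a 0)).
  (* [N] bounds what [r_plus] reads before answering [p], [v] is the use of [eta] for the first [N]
     values of [y], and [U] below keeps the first [N] entries good. *)
  destruct (eval_use _ _ _ _ (Ca (pair a 0))) as [N HN].
  fold p in HN.
  destruct (computes_use _ _ _ N Hy) as [v Hv].
  destruct (bounded_collection
    (fun n u => forall x y, computable x -> agree u zero x ->
       (forall b, b a <> p -> picks x b) -> computes eta x y ->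
       good y (k n) (t n)) N) as [U HU].
  { intros n u w L H x z Cx A P Cz; apply (H x); auto; eapply agree_le; eauto. }
  { intros n _; destruct (Ht n p) as (b & s & L & E & D).
    destruct (emits_persists _ _ _ _ _ _ R E) as [u Hu].
    exists u; intros x z Cx A P Cz.
    apply good_le with s; [exact L|]; apply (Hu x); auto. }
  set (W := N + v + U).
  (* This refutes exactly the choice of [p] for [a], at a position beyond all uses. *)
  set (x := spike (pair a (pair p W))).
  assert (Ax : agree W zero x).
  { apply spike_agree.
    pose proof (pair_ge a (pair p W)); pose proof (pair_ge p W); lia. }
  assert (Px : forall b, b a <> p -> picks x b).
  { intros b D i c; unfold x, spike.
    destruct (Nat.eqb_spec (pair i (pair (b i) c)) (pair a (pair p W))) as [e|];
      [|reflexivity].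
    exfalso; apply D.
    pose proof (f_equal left e) as e1; pose proof (f_equal right e) as e2.
    rewrite !left_pair in e1; rewrite !right_pair in e2.
    apply (f_equal left) in e2; rewrite !left_pair in e2; congruence. }
  assert (Cx : computable x) by apply computable_spike.
  destruct (R x Cx) as (y' & Hy' & Hm' & Hp').
  (* The instance [x] is still true, and a choice function avoiding [p] provides good entries for
     the new image; these fill the places from [N] on. *)
  destruct (Hm' (fun _ => S p)) as (beta & _ & G); [apply Px; lia|].
  set (k' := fun n => if Nat.ltb n N then k n else beta (pair n 0)).
  set (t' := fun n => if Nat.ltb n N then t n else beta (pair n 1)).
  destruct (Hp' k' t') as (alpha' & Ca' & P').
  { intros n; unfold k'; destruct (Nat.ltb n N); [apply Hk | apply G]. }
  { intros n; unfold k', t'; destruct (Nat.ltb_spec n N) as [L|L]; [|apply G].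
    apply (HU n L x); auto; eapply agree_le; [|exact Ax]; unfold W; lia. }
  (* The spliced witness, the image and the instance all agree with the old ones below [N]. *)
  assert (e : alpha' (pair a 0) = p).
  { eapply eval_functional; [apply Ca'|]; apply HN.
    apply bpair_agree; [apply iia_wit_agree|].
    - intros n L; unfold k'; now apply Nat.ltb_lt in L as ->.
    - intros n L; unfold t'; now apply Nat.ltb_lt in L as ->.
    - apply (Hv x); [|exact Hy']; eapply agree_le; [|exact Ax]; unfold W; lia.
    - eapply agree_le; [|exact Ax]; unfold W; lia. }
  specialize (P' a W); cbv beta in P'; rewrite e in P'.
  unfold x, spike in P'; rewrite Nat.eqb_refl in P'; discriminate.
Qed.

(** * Diagonalization against the determined values *)

(** A [k] outside E_a forces one value at [a] on all functions emitting it. Since E_(a+1) is finite,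
    some [v] exceeds all values so forced. *)
Lemma avoid_determined_values (eta r_minus r_plus : code) (a : nat) :
  reduction eta r_minus r_plus ->
  exists v, forall k b t, ambiguous r_minus (S a) k -> ~ ambiguous r_minus a k ->
    emits r_minus b k t -> b a <> v.
Proof.
  intros R; destruct (ambiguous_bounded _ _ _ (S a) R) as [M HM].
  destruct (bounded_collection
    (fun k v => ~ ambiguous r_minus a k ->
       forall b t, emits r_minus b k t -> b a < v) M) as [v Hv].
  - intros k u v L H A b t E; specialize (H A b t E); lia.
  - intros k _.
    destruct (classic (exists b t, emits r_minus b k t)) as [(b0 & t0 & E0)|none].
    + exists (S (b0 a)); intros A b t E.
      destruct (Nat.eq_dec (b a) (b0 a)); [lia|].
      exfalso; apply A; exists b, b0, t, t0; auto.
    + exists 0; intros _ b t E; exfalso; eauto.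
  - exists v; intros k b t A1 A0 E.
    specialize (Hv k (HM k A1) A0 b t E); lia.
Qed.

Theorem theorem4p15 :
  ~ m_reducible (complete [All; Ex; All]) (complete [ExInf; AllInf; All]).
Proof.
  intros (eta & rm & rp & R)%m_reducible_reduction.
  destruct (functional_choice _ (fun a => avoid_determined_values _ _ _ a R))
    as [b Hb].
  destruct (ambiguous_bounded _ _ _ 0 R) as [M HM].
  destruct (emits_unbounded _ _ _ b M R) as (k & t & L & E).
  destruct (emits_ambiguous _ _ _ _ E) as [a A].
  enough (A0 : ambiguous rm 0 k) by (specialize (HM k A0); lia).
  (* Descent from [a] to 0: if [k] were in E_(a+1) but not in E_a, the choice of [b a] would forbid
     [b] from emitting [k]. *)
  induction a as [|a IH]; [exact A|].
  apply IH, NNPP; intros NA; exact (Hb a k b t A NA E eq_refl).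
Qed.
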